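(* Let $\Omega\subset\mathbb{R}^n$ be a domain, let $\delta_0>0$ be such that $\Omega_{\delta_0}\neq\emptyset$, let $u:\Omega\to\mathbb{R}$ be a bounded subharmonic function, and let $\kappa:\mathbb{R}^+\to\mathbb{R}^+$ be a modulus of continuity such that $$\exists A>0,\qquad \limsup_{t\to0^+}\frac{\kappa(At)}{A\,\kappa(t)}<\frac1{2n} .$$ Assume that there exist constants $C_0>0$ and $0<\delta_1<\delta_0$ such that for all $0<\delta<\delta_1$, $$\Lambda_\delta u(x)-u(x)\le C_0\,\kappa(\delta)\qquad\text{for all }x\in\Omega_\delta ,$$ and that $u$ extends to a function $u:\bar\Omega\to\mathbb{R}$ which is $\kappa$-continuous near the boundary. Then $u$ is $\kappa$-continuous on $\bar\Omega$, i.e. there is a constant $L>0$ such that $$|u(x)-u(y)|\le L\,\kappa(|x-y|)\qquad\text{for all }x,y\in\bar\Omega .$$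
   Context: A modulus of continuity is a continuous increasing subadditive function $\kappa$ with $\kappa(0)=0$. For $\delta>0$, $\Omega_\delta:=\{x\in\Omega:\operatorname{dist}(x,\partial\Omega)>\delta\}$. Let $\mathbb{B}$ be the Euclidean unit ball of $\mathbb{R}^n$ and $\lambda_{\mathbb{B}}$ the normalized Lebesgue measure on $\mathbb{B}$ (total mass $1$). For $x\in\Omega_\delta$, $\Lambda_\delta u(x):=\int_{\mathbb{B}}u(x+\delta\xi)\,d\lambda_{\mathbb{B}}(\xi)$. For $u:\bar\Omega\to\mathbb{R}$ and $\delta>0$ set $$\tilde\kappa_u(\delta):=\sup\{|u(x)-u(y)|: y\in\partial\Omega,\ x\in\Omega\cap B(y,\delta)\}.$$ The function $u:\bar\Omega\to\mathbb{R}$ is $\kappa$-continuous near the boundary if there exists a constant $C>0$ such that $\tilde\kappa_u(\delta)\le C\,\kappa(\delta)$ for all sufficiently small $\delta>0$. *)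

(* Defs.v *)
From HB Require Import structures.
From mathcomp Require Import all_boot all_order all_algebra.
From mathcomp Require Import all_classical all_reals all_analysis.

Set Implicit Arguments.
Unset Strict Implicit.
Unset Printing Implicit Defensive.

Import Order.TTheory GRing.Theory Num.Theory.
Import numFieldNormedType.Exports.

Local Open Scope classical_set_scope.
Local Open Scope ring_scope.

(* The topology on R^n is that of ['rV[R]_n], but the sigma-algebra and
   Lebesgue measure are those of [n.-tuple R]; [vec] below identifies the two.
   Lebesgue measure on R^(n+1) is the image of the product of the Lebesgue
   measures on R and on R^n under (t, w) |-> t :: w. *)
Section LebesgueMeasure.
Context (R : realType).
Local Notation T := (measurableTypeR R).

Definition cons_tuple n (p : T * n.-tuple T) : n.+1.-tuple T :=
  [the n.+1.-tuple T of p.1 :: p.2].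

Lemma measurable_cons_tuple n :
  measurable_fun [set: T * n.-tuple T] (@cons_tuple n).
Proof. exact: measurable_cons. Qed.

Section successor.
Variables (n : nat) (mu : {sigma_finite_measure set (n.-tuple T) -> \bar R}).

Definition lebesgue_succ : set (n.+1.-tuple T) -> \bar R :=
  pushforward (@lebesgue_measure R \x mu)%E (@cons_tuple n).

HB.instance Definition _ := Measure.copy lebesgue_succ
  (measure_function_pushforward__canonical__measure_function_Measure
     (@lebesgue_measure R \x mu)%E (@measurable_cons_tuple n)).

Lemma lebesgue_succ_sigma_finite : sigma_finite setT lebesgue_succ.
Proof.
pose uncons (w : n.+1.-tuple T) : T * n.-tuple T :=
  (thead w, [tuple of behead w]).
have consK : cancel (@cons_tuple n) uncons.
  by case=> t w; congr pair; apply: val_inj.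
have munc : measurable_fun setT uncons.
  apply/measurable_fun_pairP; split; first exact: measurable_tnth.
  exact: measurable_behead.
have /sigma_finiteP[F [TF ndF Foo]] := sigma_finiteT (@lebesgue_measure R).
have /sigma_finiteP[G [TG ndG Goo]] := sigma_finiteT mu.
exists (fun k => uncons @^-1` (F k `*` G k)).
  rewrite -preimage_bigcup -[LHS](preimage_setT uncons); congr (_ @^-1` _).
  apply/esym/seteqP; split=> // -[t w] _.
  have [i _ Fit] : (\bigcup_i F i) t by rewrite -TF.
  have [j _ Gjw] : (\bigcup_j G j) w by rewrite -TG.
  exists (maxn i j) => //; split => /=.
    by move: t Fit; exact/subsetPset/ndF/leq_maxl.
  by move: w Gjw; exact/subsetPset/ndG/leq_maxr.
move=> k; have [mF Fk] := Foo k; have [mG Gk] := Goo k; split.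
  by rewrite -[X in measurable X]setTI; apply: munc => //; exact: measurableX.
rewrite /lebesgue_succ /pushforward -comp_preimage.
rewrite (_ : uncons \o _ = id); last by apply/funext => p /=; rewrite consK.
rewrite [X in (X < _)%E]product_measure1E//.
by rewrite lte_mul_pinfty// ge0_fin_numE.
Qed.

HB.instance Definition _ := Measure_isSigmaFinite.Build _ _ _
  lebesgue_succ lebesgue_succ_sigma_finite.

End successor.

Fixpoint lebesgue_tuple (n : nat) :
    {sigma_finite_measure set (n.-tuple T) -> \bar R} :=
  match n with
  | 0 => dirac [tuple]
  | m.+1 => lebesgue_succ (lebesgue_tuple m)
  end.

End LebesgueMeasure.

Section Definitions.
Context (R : realType) (n : nat).
Implicit Types (Omega A : set 'rV[R]_n) (u : 'rV[R]_n -> R) (k : R -> R).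

Definition vec (w : n.-tuple (measurableTypeR R)) : 'rV[R]_n :=
  \row_i tnth w i.

(* The library's norm on ['rV[R]_n] is the sup norm. *)
Definition enorm (x : 'rV[R]_n) : R := Num.sqrt (\sum_i x ord0 i ^+ 2).

Definition unit_ball : set 'rV[R]_n := [set x | enorm x < 1].

Definition domain Omega := [/\ open Omega, connected Omega & Omega !=set0].

Definition boundary A : set 'rV[R]_n := closure A `\` A°.

(* The distance to the empty set is +oo. *)
Definition dist (x : 'rV[R]_n) A : \bar R :=
  ereal_inf [set (enorm (x - y))%:E | y in A].

Definition inner Omega (delta : R) : set 'rV[R]_n :=
  [set x | Omega x /\ (delta%:E < dist x (boundary Omega))%E].

Definition ball_mean (delta : R) u (x : 'rV[R]_n) : R :=
  (fine (lebesgue_tuple R n (vec @^-1` unit_ball)))^-1 *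
  \int[lebesgue_tuple R n]_(xi in vec @^-1` unit_ball) u (x + delta *: vec xi).

(* Upper semicontinuity and the sub-mean value inequality on every closed ball
   contained in [Omega]; values of [u] outside [Omega] are irrelevant. *)
Definition subharmonic Omega u :=
  (forall (x : 'rV[R]_n) (a : R), Omega x -> u x < a -> \forall y \near x, u y < a) /\
  (forall (x : 'rV[R]_n) (r : R), 0 < r -> [set y | enorm (y - x) <= r] `<=` Omega ->
     u x <= ball_mean r u x).

Definition bounded_fun_on Omega u :=
  exists M : R, forall x, Omega x -> `|u x| <= M.

Record modulus_of_continuity k : Prop := ModulusOfContinuity {
  modulus_continuous : {within [set t : R | 0 <= t], continuous k};
  modulus_increasing : forall s t : R, 0 <= s -> s <= t -> k s <= k t;
  modulus_subadditive : forall s t : R,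
    0 <= s -> 0 <= t -> k (s + t) <= k s + k t;
  modulus0 : k 0 = 0 }.

Definition boundary_modulus Omega u (delta : R) : \bar R :=
  ereal_sup [set r | exists x y, [/\ boundary Omega y, Omega x,
    enorm (x - y) < delta & r = `|u x - u y|%:E]].

Definition continuous_near_boundary Omega k u :=
  exists2 C : R, 0 < C &
    \forall delta \near 0^'+,
      (boundary_modulus Omega u delta <= (C * k delta)%:E)%E.

Definition modulus_continuous_on A k u :=
  exists2 L : R, 0 < L &
    forall x y, A x -> A y -> `|u x - u y| <= L * k (enorm (x - y)).

End Definitions.

(* Main.v *)
Require Import Defs.
From mathcomp Require Import all_boot all_order all_algebra.
From mathcomp Require Import all_classical all_reals all_analysis.
From mathcomp Require Import measurable_realfun.
From mathcomp Require Import ring lra.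

Import Order.TTheory GRing.Theory Num.Theory.
Import numFieldNormedType.Exports.

Local Open Scope classical_set_scope.
Local Open Scope ring_scope.

(** Write [w d] for the largest increment of [u] between points of [Omega] at
distance at most [d].  The theorem follows from an inequality
[w d <= e * w (B * d) + O(kappa d)] in which [e * kappa (B * d)] is at most
[kappa d / 2]: dividing by [kappa d] and iterating from small scales up to a
fixed one, where [u] is merely bounded, bounds [w d / kappa d]
([modulus_interior]).

The inequality has two cases.  If [x] is within [B * d] of the boundary, both
[x] and a point [y] with [|y - x| <= d] are close to one boundary point and the
boundary modulus bounds [u y - u x].  Otherwise the closed ball of centre [x]
and radius [B * d] lies in [Omega] ([closed_ball_sub]).  It contains the ball
of centre [y] and radius [(B - 1) * d], so for any lower bound [m] of [u] on
the large ball, positivity of [u - m] compares the two averages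
([ball_mean_le]):

  [u y - m <= mean_y (u - m) <= (B / (B - 1)) ^ n * mean_x (u - m)].

Take [m = u x - w (B * d)].  As [mean_x u <= u x + C0 * kappa (B * d)], this
reads [u y - u x <= q * (C0 * kappa (B * d) + w (B * d)) - w (B * d)] with
[q = (B / (B - 1)) ^ n <= 1 + 2 ^ (n + 1) / B] ([one_scale_estimate],
[ball_ratio_le]), hence [e = 2 ^ (n + 1) / B].

The scale [B] comes from the condition on [kappa] ([modulus_scale]).  Since
[1 / (2 n) <= 1 / 2], that condition gives
[kappa (A * t) <= (A / 2) * kappa t] for small [t]; iterating it [n + 2] times,
[B = A ^ (n + 2)] satisfies [kappa (B * t) <= B / 2 ^ (n + 2) * kappa t], which
is the required bound on [e * kappa (B * d)].

Comparing averages over balls of different centres and radii rests on the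
change of variables [w |-> a + s w] for the Lebesgue measure on tuples
([lebesgue_tuple_affine]).  Points of the closure are finally reached through
nearby points of [Omega] ([modulus_closure]). *)

(** * Lebesgue measure on tuples *)

Section LebesgueTuple.
Context {R : realType}.
Local Notation T := (measurableTypeR R).
Local Notation pushforward_measure :=
  measure_function_pushforward__canonical__measure_function_Measure.
Local Notation consT := (@Defs.cons_tuple R _).

Definition affine (a s : R) (t : T) : T := a + s * t.

Definition affine_tuple {n} (a : 'I_n -> R) (s : R) (w : n.-tuple T) :
    n.-tuple T :=
  [tuple affine (a i) s (tnth w i) | i < n].

Lemma measurable_affine (a s : R) :
  measurable_fun [set: T] (affine a s).
Proof. by apply: measurable_funD => //; exact: measurable_funM. Qed.

Lemma measurable_affine_tuple n (a : 'I_n -> R) (s : R) :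
  measurable_fun setT (affine_tuple a s).
Proof.
apply/measurable_fun_tnthP => i.
rewrite (_ : _ \o _ = (affine (a i) s) \o (@tnth n T ^~ i)).
  by apply: measurableT_comp; [exact: measurable_affine | exact: measurable_tnth].
by apply/funext => w /=; rewrite tnth_mktuple.
Qed.

(** By uniqueness of Lebesgue measure it suffices to compare both sides on
half-open intervals. *)
Lemma lebesgue_measure_affine (a s : R) (A : set T) : 0 < s -> measurable A ->
  (s%:E * lebesgue_measure ((affine a s) @^-1` A))%E =
  lebesgue_measure A.
Proof.
move=> s0 mA.
pose m : {measure set T -> \bar R} :=
  mscale (NngNum (ltW s0)) (pushforward_measure
     (@lebesgue_measure R) (measurable_affine a s)).
apply/esym/(@lebesgue_measure_unique R m) => // _ [[b c]] _ <-.
rewrite /m /= /mscale /= /pushforward.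
rewrite (_ : _ @^-1` _ = `](b - a) / s, (c - a) / s]%classic); last first.
  apply/seteqP; split=> t; rewrite /= /affine !in_itv /=;
    by rewrite ltr_pdivrMr// ler_pdivlMr// ltrBlDl lerBrDl [t * s]mulrC.
rewrite !lebesgue_measure_itv /= !lte_fin ltr_pM2r ?invr_gt0// ltrD2r.
case: ifP => _; last by rewrite mule0.
rewrite -!EFinD -EFinM; congr EFin.
by rewrite -mulrBl mulrC divfK ?gt_eqF//; ring.
Qed.

Lemma affine_cons_tuple n (a : 'I_n.+1 -> R) (s : R) (p : T * n.-tuple T) :
  affine_tuple a s (consT p) =
  consT (affine (a ord0) s p.1,
         affine_tuple (fun i => a (lift ord0 i)) s p.2).
Proof.
apply: eq_from_tnth => i; rewrite tnth_mktuple.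
case: (unliftP ord0 i) => [j ->|->]; first by rewrite !tnthS tnth_mktuple.
by rewrite !tnth0.
Qed.

Lemma lebesgue_tupleS n (A : set (n.+1.-tuple T)) :
  lebesgue_tuple R n.+1 A =
  (\int[@lebesgue_measure R]_t
     lebesgue_tuple R n (xsection (consT @^-1` A) t))%E.
Proof. by []. Qed.

(** Induction on [n].  The section at [t] of the preimage of [A] is the preimage,
under the affine map on the last coordinates, of the section of [A] at
[a 0 + s t].  The induction hypothesis extracts the factor [s ^- n], and the
substitution in the first coordinate the remaining [s^-1]. *)
Lemma lebesgue_tuple_affine n (a : 'I_n -> R) (s : R) (A : set (n.-tuple T)) :
  0 < s -> measurable A ->
  ((s ^+ n)%:E * lebesgue_tuple R n (affine_tuple a s @^-1` A))%E =
  lebesgue_tuple R n A.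
Proof.
move=> s0; elim: n a A => [|n IH] a A mA.
  rewrite expr0 mul1e; congr (lebesgue_tuple R 0 _).
  by apply/seteqP; split=> w; rewrite /preimage /= [affine_tuple _ _ _]tuple0 [w]tuple0.
rewrite !lebesgue_tupleS.
have mcA : measurable (consT @^-1` A).
  by rewrite -[X in measurable X]setTI; exact: measurable_cons_tuple.
have mg : measurable_fun setT
    (fun t => lebesgue_tuple R n (xsection (consT @^-1` A) t)).
  exact: measurable_fun_xsection.
set g := fun t => _ in mg *.
have sn0 : 0 < s ^+ n by rewrite exprn_gt0.
have gE (t : T) : lebesgue_tuple R n (xsection (consT @^-1`
    (affine_tuple a s @^-1` A)) t) = ((s ^- n)%:E * (g \o affine (a ord0) s) t)%E.
  rewrite /g /= -(IH (fun i => a (lift ord0 i))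
    (xsection (consT @^-1` A) (affine (a ord0) s t))); last first.
    exact: measurable_xsection.
  rewrite muleA -EFinM mulVf ?gt_eqF// mul1e; congr (lebesgue_tuple R n _).
  by apply/seteqP; split=> w; rewrite /xsection /preimage /= !inE /= affine_cons_tuple.
under eq_integral do rewrite gE.
rewrite ge0_integralZl//; last 2 first.
- by apply: measurableT_comp => //; exact: measurable_affine.
- by rewrite lee_fin invr_ge0 ltW.
rewrite muleA -EFinM exprSr mulrAC mulfV ?gt_eqF// mul1r.
have maff := measurable_affine (a ord0) s.
transitivity (s%:E * \int[pushforward lebesgue_measure (affine (a ord0) s)]_t g t)%E.
  by rewrite (ge0_integral_pushforward maff)// => t _; exact: measure_ge0.
pose m : {measure set T -> \bar R} :=
  pushforward_measure (@lebesgue_measure R) maff.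
have := @ge0_integral_mscale _ _ R m setT measurableT (NngNum (ltW s0)) g mg.
move=> /(_ (fun t _ => measure_ge0 _ _)) <-.
apply: eq_measure_integral => B mB _.
exact: lebesgue_measure_affine.
Qed.

Lemma ge0_integral_affine_tuple n (a : 'I_n -> R) (s : R)
    (D : set (n.-tuple T)) (f : n.-tuple T -> \bar R) :
  0 < s -> measurable D -> measurable_fun D f ->
  (forall w, D w -> 0 <= f w)%E ->
  ((s ^+ n)%:E * \int[lebesgue_tuple R n]_(w in affine_tuple a s @^-1` D)
     f (affine_tuple a s w))%E =
  (\int[lebesgue_tuple R n]_(w in D) f w)%E.
Proof.
move=> s0 mD mf f0; have maff := measurable_affine_tuple n a s.
transitivity ((s ^+ n)%:E *
    \int[pushforward (lebesgue_tuple R n) (affine_tuple a s)]_(w in D) f w)%E.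
  by rewrite (ge0_integral_pushforward maff)// => w /set_mem; exact: f0.
pose m : {measure set (n.-tuple T) -> \bar R} :=
  pushforward_measure (lebesgue_tuple R n) maff.
have sn0 : 0 <= s ^+ n by rewrite exprn_ge0// ltW.
rewrite -[LHS](@ge0_integral_mscale _ _ R m D mD (NngNum sn0) f)//.
apply: eq_measure_integral => B mB _.
exact: lebesgue_tuple_affine.
Qed.

(** Cubes are products, so their volume is explicit; they serve to show that the
unit ball has finite nonzero volume. *)
Definition cube n (r : R) : set (n.-tuple T) :=
  [set w | forall i, - r < tnth w i < r].

Lemma measurable_cube n r : measurable (cube n r).
Proof.
rewrite (_ : cube n r = \bigcap_(i in [set: 'I_n])
    ((@tnth n T ^~ i) @^-1` `]- r, r[%classic)).
  apply: fin_bigcap_measurable => // i _.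
  by rewrite -[X in measurable X]setTI; apply: measurable_tnth.
apply/seteqP; split=> w; first by move=> h i _; rewrite /= in_itv /= h.
by move=> h i; have := h i I; rewrite /= in_itv.
Qed.

Lemma lebesgue_cube n r : 0 < r -> lebesgue_tuple R n (cube n r) = ((r *+ 2) ^+ n)%:E.
Proof.
move=> r0; elim: n => [|n IH].
  rewrite expr0 /= diracE mem_set// => -[]; by case.
pose J : set T := `]- r, r[%classic.
have mJ : measurable J by exact: measurable_itv.
rewrite [LHS](_ : _ = ((@lebesgue_measure R \x lebesgue_tuple R n)
    (J `*` cube n r))%E); last first.
  rewrite /= /lebesgue_succ /pushforward; congr (_ _).
  apply/seteqP; split=> -[t w]; rewrite /J /=.
    rewrite /cube /= => h; split; first by have := h ord0; rewrite in_itv tnth0.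
    by move=> i; have := h (lift ord0 i); rewrite tnthS.
  rewrite in_itv /= => -[h0 h] i.
  by case: (unliftP ord0 i) => [j ->|->]; rewrite ?tnthS ?tnth0.
rewrite [LHS]product_measure1E//; last exact: measurable_cube.
rewrite IH [X in (X * _)%E]lebesgue_measure_itv /= lte_fin ifT; last by lra.
by rewrite opprK exprS.
Qed.

End LebesgueTuple.

(** * The Euclidean norm *)

Section Euclidean.
Context {R : realType} {n : nat}.
Implicit Types (x y z : 'rV[R]_n).

Lemma enorm_ge0 x : 0 <= enorm x.
Proof. exact: sqrtr_ge0. Qed.

Lemma sum_sqr_ge0 x : 0 <= \sum_i x ord0 i ^+ 2.
Proof. by apply: sumr_ge0 => i _; exact: sqr_ge0. Qed.

Lemma sqr_enorm x : enorm x ^+ 2 = \sum_i x ord0 i ^+ 2.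
Proof. by rewrite sqr_sqrtr// sum_sqr_ge0. Qed.

Lemma enorm0 : enorm (0 : 'rV[R]_n) = 0.
Proof. by rewrite /enorm big1 ?sqrtr0// => i _; rewrite mxE expr0n. Qed.

Lemma enormZ (a : R) x : 0 <= a -> enorm (a *: x) = a * enorm x.
Proof.
move=> a0; rewrite /enorm.
under eq_bigr do rewrite mxE exprMn.
by rewrite -mulr_sumr sqrtrM ?sqr_ge0// sqrtr_sqr ger0_norm.
Qed.

Lemma enormN x : enorm (- x) = enorm x.
Proof. by rewrite /enorm; under eq_bigr do rewrite mxE sqrrN. Qed.

Lemma enormC x y : enorm (x - y) = enorm (y - x).
Proof. by rewrite -enormN opprB. Qed.

Lemma enorm_eq0 x : enorm x = 0 -> x = 0.
Proof.
move=> /(congr1 (fun t => t ^+ 2)); rewrite sqr_enorm expr0n /= => /eqP.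
rewrite psumr_eq0 => [/allP h|i _]; last exact: sqr_ge0.
apply/rowP => i; rewrite mxE; apply/eqP.
by have := h i (mem_index_enum _); rewrite sqrf_eq0.
Qed.

Lemma cauchy_schwarz x y :
  \sum_i x ord0 i * y ord0 i <= enorm x * enorm y.
Proof.
set S := \sum_i _.
(* This is the nonnegativity of |s x - t y|^2, used for s = |y| and t = |x|. *)
have H (s t : R) : 2 * (s * t) * S <= s ^+ 2 * enorm x ^+ 2 + t ^+ 2 * enorm y ^+ 2.
  rewrite !sqr_enorm !mulr_sumr -big_split /=; apply: ler_sum => i _.
  by have := sqr_ge0 (s * x ord0 i - t * y ord0 i); lra.
have [/enorm_eq0 x0|x0] := eqVneq (enorm x) 0.
  by rewrite /S x0 enorm0 mul0r big1// => i _; rewrite mxE mul0r.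
have [/enorm_eq0 y0|y0] := eqVneq (enorm y) 0.
  by rewrite /S y0 enorm0 mulr0 big1// => i _; rewrite mxE mulr0.
have xy0 : 0 < enorm y * enorm x by rewrite mulr_gt0// lt0r enorm_ge0 ?x0 ?y0.
by rewrite -(ler_pM2l xy0); have := H (enorm y) (enorm x); lra.
Qed.

Lemma enormD x y : enorm (x + y) <= enorm x + enorm y.
Proof.
rewrite -(ler_pXn2r (ltn0Sn 1)) ?nnegrE ?addr_ge0 ?enorm_ge0//.
rewrite sqrrD !sqr_enorm.
under eq_bigr do rewrite mxE sqrrD.
rewrite !big_split /= lerD2r lerD2l.
by rewrite -mulr2n lerMn2r cauchy_schwarz orbT.
Qed.

Lemma enorm_triangle z x y : enorm (x - y) <= enorm (x - z) + enorm (z - y).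
Proof. by rewrite -[x - y](subrKA z) enormD. Qed.

Lemma enorm_continuous : continuous (@enorm R n).
Proof.
move=> x.
apply: (@continuous_comp _ _ _ (fun x => \sum_i x ord0 i ^+ 2) Num.sqrt); last first.
  exact: sqrt_continuous.
apply: continuous_big => [|i _]; first exact: add_continuous.
move=> y; apply: (@continuous_comp _ _ _ (fun x => x ord0 i) (fun t => t ^+ 2)).
  exact: coord_continuous.
exact: exprn_continuous.
Qed.

Lemma affine_continuous x (s : R) : continuous (fun y => x + s *: y).
Proof. by move=> y; exact: (cvgD (cvg_cst x) (cvgZl_tmp (k := s) (f := id) cvg_id)). Qed.

Lemma open_unit_ball : open (@unit_ball R n).
Proof.
rewrite (_ : @unit_ball R n = @enorm R n @^-1` [set t | t < 1])//.
by apply: open_comp => [x _|]; [exact: enorm_continuous | exact: open_lt].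
Qed.

Lemma vecE (w : n.-tuple (measurableTypeR R)) (i : 'I_1) j : vec w i j = tnth w j.
Proof. by rewrite mxE. Qed.

(** An open set is a union of sup-norm balls of rational centre and radius
[1 / (k + 1)]: a countable union, each ball being a finite intersection of
coordinate conditions.  This links the topology of row vectors to the product
sigma-algebra of tuples. *)
Lemma measurable_preimage_vec (U : set 'rV[R]_n) : open U ->
  measurable (@vec R n @^-1` U).
Proof.
move=> oU.
pose c (p : 'rV[rat]_n * nat) : 'rV[R]_n := map_mx ratr p.1.
pose P := [set p | ball (c p) (p.2.+1%:R^-1) `<=` U].
rewrite (_ : _ @^-1` U =
    \bigcup_(p in P) (@vec R n @^-1` ball (c p) (p.2.+1%:R^-1))); last first.
  apply/seteqP; split=> w /=; last by move=> [p Pp] /Pp.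
  move=> Uw; have /nbhs_ballP[e /= e0 ewU] : nbhs (vec w) U by exact: open_nbhs_nbhs.
  have [k ke] : exists k : nat, k.+1%:R^-1 < e / 2.
    have e20 : 0 < e / 2 by rewrite divr_gt0.
    have [k _ kP] := near_infty_natSinv_lt (PosNum e20).
    by exists k; exact: (kP k (leqnn k)).
  have k0 : (0 : R) < k.+1%:R^-1 by rewrite invr_gt0.
  have [q qP] : exists q : 'rV[rat]_n, ball (vec w) k.+1%:R^-1 (map_mx ratr q : 'rV[R]_n).
    have h i : {q : rat | ball (tnth w i : R) k.+1%:R^-1 (ratr q)}.
      have /rat_in_itvoo/cid[q] :
          (tnth w i : R) < (tnth w i : R) + k.+1%:R^-1 by rewrite ltrDl.
      rewrite in_itv /= => /andP[q1 q2]; exists q.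
      by rewrite ball_itv /= in_itv /= q2 andbT (lt_trans _ q1)// ltrBlDr ltrDl.
    exists (\row_i sval (h i)); split => // i j; rewrite !mxE; exact: (svalP (h j)).
  exists (q, k); last exact: ball_sym.
  move=> z /= zq; apply: ewU; rewrite (splitr e).
  by apply: (ball_triangle (le_ball (ltW ke) qP)); exact: (le_ball (ltW ke)).
rewrite bigcup_mkcond; apply: countable_bigcupT_measurable => [|p].
  exact: countableP.
case: ifP => // _.
rewrite (_ : _ @^-1` _ = \bigcap_(i in [set: 'I_n]) ((@tnth n (measurableTypeR R) ^~ i)
    @^-1` (ball (c p ord0 i : R) p.2.+1%:R^-1))).
  apply: fin_bigcap_measurable => // i _.
  rewrite -[X in measurable X]setTI; apply: measurable_tnth => //.
  by rewrite ball_itv; exact: measurable_itv.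
apply/seteqP; split=> w; first by move=> [_ h] i _; have := h ord0 i; rewrite vecE.
move=> h; split; first by rewrite invr_gt0.
by move=> i j; rewrite [i]ord1 vecE; exact: h.
Qed.

Lemma vec_affine_tuple (a : 'I_n -> R) s w :
  vec (affine_tuple a s w) = \row_i a i + s *: vec w.
Proof. by apply/rowP => i; rewrite !mxE tnth_mktuple. Qed.

End Euclidean.

(** * Averages over balls *)

Section MeanValue.
Context {R : realType} {n : nat}.
Implicit Types (x y z : 'rV[R]_n) (Omega : set 'rV[R]_n) (u : 'rV[R]_n -> R).
Local Notation mu := (lebesgue_tuple R n).
Local Notation D := (@vec R n @^-1` @unit_ball R n).

Lemma measurable_ball_tuple : measurable D.
Proof. apply: measurable_preimage_vec; exact: open_unit_ball. Qed.

Lemma coord_le_enorm x i : `|x ord0 i| <= enorm x.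
Proof.
rewrite -sqrtr_sqr; apply: ler_wsqrtr; rewrite (bigD1 i)//= lerDl.
by apply: sumr_ge0 => j _; exact: sqr_ge0.
Qed.

Lemma lebesgue_ball_lty : (mu D < +oo)%E.
Proof.
apply: (@le_lt_trans _ _ (mu (cube n 1))); last by rewrite lebesgue_cube ?ltry.
apply: le_measure; rewrite ?inE; [exact: measurable_ball_tuple|exact: measurable_cube|].
move=> w /= w1 i; rewrite -ltr_norml (le_lt_trans _ w1)//.
by rewrite (le_trans _ (coord_le_enorm _ i))// vecE.
Qed.

Lemma lebesgue_ball_gt0 : (0 < mu D)%E.
Proof.
(* The cube of half-side 1 / (n + 1) is contained in the ball, since
   n / (n + 1) ^ 2 < 1. *)
pose e : R := n.+1%:R^-1.
have e0 : 0 < e by rewrite invr_gt0.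
apply: (@lt_le_trans _ _ (mu (cube n e))).
  by rewrite lebesgue_cube// lte_fin exprn_gt0// mulrn_wgt0.
apply: le_measure; rewrite ?inE; [exact: measurable_cube|exact: measurable_ball_tuple|].
move=> w we; rewrite /unit_ball /= -(ltr_pXn2r (ltn0Sn 1)) ?nnegrE ?enorm_ge0//.
rewrite sqr_enorm expr1n (@le_lt_trans _ _ (\sum_(i < n) e))//.
  apply: ler_sum => i _; rewrite vecE -real_normK ?num_real//.
  have wi : `|tnth w i| < e by rewrite ltr_norml; exact: we.
  have e1 : e <= 1 by rewrite invf_le1// ler1n.
  rewrite (le_trans (y := e ^+ 2))//.
    by rewrite ler_pXn2r ?nnegrE// ltW.
  by rewrite expr2 ger_pMl.
by rewrite sumr_const card_ord -[_ *+ _]mulr_natl ltr_pdivrMr// mul1r ltr_nat.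
Qed.

Local Notation V := (fine (mu D)).

Lemma ball_volume_gt0 : 0 < V.
Proof. by rewrite fine_gt0// lebesgue_ball_gt0 lebesgue_ball_lty. Qed.

(** The first half of the definition of subharmonicity, in isolation: it is what
makes the integrands measurable. *)
Definition usc_on Omega u := forall x (a : R),
  Omega x -> u x < a -> \forall y \near x, u y < a.

Lemma usc_open Omega u (a : R) : open Omega -> usc_on Omega u ->
  open (Omega `&` [set z | u z < a]).
Proof.
move=> oO uscu; rewrite openE => z [Oz uz]; apply: filterI.
  exact: open_nbhs_nbhs.
exact: uscu.
Qed.

Lemma ball_affine x (r : R) Omega : 0 < r ->
  [set y | enorm (y - x) <= r] `<=` Omega ->
  forall v, unit_ball v -> Omega (x + r *: v).
Proof.
move=> r0 xO v v1; apply: xO => /=.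
rewrite addrAC subrr add0r enormZ; last exact: ltW.
by rewrite ger_pMr// ltW.
Qed.

Lemma measurable_usc_affine Omega u x r : open Omega -> usc_on Omega u ->
  (forall v, unit_ball v -> Omega (x + r *: v)) ->
  measurable_fun D (fun w => u (x + r *: vec w)).
Proof.
move=> oO uscu xO.
apply: (@measurability _ _ _ _ _ _ (@RGenInftyO.G R)).
  exact: RGenInftyO.measurableE.
move=> /= _ [_ [a ->] <-].
rewrite (_ : _ `&` _ = @vec R n @^-1` (@unit_ball R n `&`
    (fun v => x + r *: v) @^-1` (Omega `&` [set z | u z < a]))).
  apply: measurable_preimage_vec; apply: openI; first exact: open_unit_ball.
  apply: open_comp; last exact: usc_open.
  by move=> v _; exact: affine_continuous.
apply/seteqP; split=> w /=; rewrite in_itv /=.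
  by move=> [w1 wa]; split => //; split => //; exact: xO.
by move=> [w1 [_ wa]]; split.
Qed.

Lemma integrable_usc_affine Omega u M x r : open Omega -> usc_on Omega u ->
  (forall z, Omega z -> `|u z| <= M) ->
  (forall v, unit_ball v -> Omega (x + r *: v)) ->
  mu.-integrable D (EFin \o (fun w => u (x + r *: vec w))).
Proof.
move=> oO uscu uM xO; apply: measurable_bounded_integrable.
- exact: measurable_ball_tuple.
- exact: lebesgue_ball_lty.
- exact: (measurable_usc_affine _ _ _ _ oO uscu xO).
exists M; split; first exact: num_real.
by move=> N MN w Dw; apply: le_trans (ltW MN); apply: uM; exact: xO.
Qed.

(** The averages are normalized, so subtracting a constant from [u] subtracts it
from the mean. *)
Lemma ball_meanB Omega u M x r (m : R) : open Omega -> usc_on Omega u ->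
  (forall z, Omega z -> `|u z| <= M) ->
  (forall v, unit_ball v -> Omega (x + r *: v)) ->
  ball_mean r u x - m = V^-1 * \int[mu]_(w in D) (u (x + r *: vec w) - m).
Proof.
move=> oO uscu uM xO; have mD := measurable_ball_tuple.
rewrite RintegralB//; last 2 first.
- exact: (integrable_usc_affine _ _ _ _ _ oO uscu uM xO).
- apply: measurable_bounded_integrable => //; first exact: lebesgue_ball_lty.
  by exists `|m|; split; [exact: num_real | move=> N mN w _; exact: ltW].
rewrite Rintegral_cst// mulrBr mulrCA mulVf ?mulr1//.
by rewrite gt_eqF// ball_volume_gt0.
Qed.

(** The ball of centre [y] and radius [r] lies in that of centre [x] and radius
[rho], and [u - m] is nonnegative on the latter, so the integral of [u - m] over
the small ball is at most that over the large one; normalization by the volumes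
contributes the factor [(rho / r) ^ n].  On the unit ball the inclusion is the
affine map [w |-> (y - x) / rho + (r / rho) w]. *)
Lemma ball_mean_le Omega u M x y (r rho m : R) : open Omega -> usc_on Omega u ->
  (forall z, Omega z -> `|u z| <= M) ->
  0 < r -> r + enorm (y - x) <= rho ->
  [set z | enorm (z - x) <= rho] `<=` Omega ->
  (forall z, enorm (z - x) <= rho -> m <= u z) ->
  ball_mean r u y - m <= (rho / r) ^+ n * (ball_mean rho u x - m).
Proof.
move=> oO uscu uM r0 rrho xO mu_le.
have rho0 : 0 < rho by rewrite (lt_le_trans _ rrho)// ltr_pwDl ?enorm_ge0.
have xB := @ball_affine x rho Omega rho0 xO.
have yxB z : enorm (z - y) <= r -> enorm (z - x) <= rho.
  by move=> zy; rewrite (le_trans (enorm_triangle y _ _))// (le_trans _ rrho)// lerD2r.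
have yB : forall v, unit_ball v -> Omega (y + r *: v).
  by apply: ball_affine => // z /= /yxB /xO.
rewrite !(ball_meanB Omega u M _ _ m oO uscu uM)// mulrCA.
rewrite ler_pM2l ?invr_gt0 ?ball_volume_gt0//.
have mD := measurable_ball_tuple.
have mf z t : (forall v, unit_ball v -> Omega (z + t *: v)) ->
    measurable_fun D (fun w => (u (z + t *: vec w) - m)%:E).
  move=> zB; apply/measurable_EFinP; apply: measurable_funB => //.
  exact: (measurable_usc_affine _ _ _ _ oO uscu zB).
have intf z t : (forall v, unit_ball v -> Omega (z + t *: v)) ->
    (\int[mu]_(w in D) (u (z + t *: vec w) - m)%:E)%E \is a fin_num.
  move=> zB; apply: integrable_fin_num => //.
  apply: (@integrableB _ _ _ _ _ mD (fun w => (u (z + t *: vec w))%:E) (cst m%:E)).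
    exact: (integrable_usc_affine _ _ _ _ _ oO uscu uM zB).
  apply: (@measurable_bounded_integrable _ _ _ _ (cst m)) => //.
    exact: lebesgue_ball_lty.
  by exists `|m|; split; [exact: num_real | move=> N mN w _; exact: ltW].
rewrite -lee_fin EFinM !fineK; [|exact: intf..].
set s := r / rho.
have s0 : 0 < s by rewrite divr_gt0.
pose a i := (rho^-1 *: (y - x)) ord0 i.
have aE w : x + rho *: vec (affine_tuple a s w) = y + r *: vec w.
  rewrite vec_affine_tuple (_ : \row_i a i = rho^-1 *: (y - x)); last first.
    by apply/rowP => i; rewrite mxE.
  rewrite scalerDr !scalerA mulfV ?gt_eqF// scale1r /s mulrCA mulfV ?gt_eqF// mulr1.
  by rewrite addrA subrKC.
have DsubD : D `<=` affine_tuple a s @^-1` D.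
  move=> w /= w1; rewrite /unit_ball /= -(ltr_pM2l rho0) mulr1 -enormZ ?ltW//.
  have -> : rho *: vec (affine_tuple a s w) = (y - x) + r *: vec w.
    by rewrite -[LHS](addKr x) aE addrA [- x + y]addrC.
  rewrite (le_lt_trans (enormD _ _))// (lt_le_trans _ rrho)// addrC ltrD2r.
  by rewrite enormZ ?ltW// gtr_pMr.
rewrite -(ge0_integral_affine_tuple n a s D
  (fun w => (u (x + rho *: vec w) - m)%:E))//; last 2 first.
- exact: mf.
- move=> w w1; rewrite lee_fin subr_ge0 mu_le//.
  exact: (ball_affine x rho [set z | enorm (z - x) <= rho] rho0 (fun _ => id) _ w1).
rewrite muleA -EFinM -exprMn {2}/s mulrA divfK ?gt_eqF// mulfV ?gt_eqF// expr1n mul1e.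
under [leRHS]eq_integral do rewrite aE.
have mT : measurable (affine_tuple a s @^-1` D).
  by rewrite -[X in measurable X]setTI; exact: measurable_affine_tuple.
apply: ge0_subset_integral => // [|w w1].
  under eq_fun do rewrite -aE.
  apply: (measurable_comp mD _ (mf _ _ xB)); first by move=> _ [w w1 <-].
  apply: measurable_funTS; exact: measurable_affine_tuple.
rewrite -aE lee_fin subr_ge0 mu_le//.
exact: (ball_affine x rho [set z | enorm (z - x) <= rho] rho0 (fun _ => id) _ w1).
Qed.

End MeanValue.

(** * Balls and the boundary *)

Section Boundary.
Context {R : realType} {n : nat}.
Implicit Types (x y z : 'rV[R]_n) (Omega : set 'rV[R]_n) (u : 'rV[R]_n -> R).

Lemma closureE_boundary Omega x : open Omega -> closure Omega x -> ~ Omega x ->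
  boundary Omega x.
Proof.
by move=> oO cx nx; split => //; rewrite (iffLR (interior_id _) oO).
Qed.

Lemma nbhs_enorm x (d : R) : 0 < d -> nbhs x [set z | enorm (z - x) < d].
Proof.
move=> d0; apply: open_nbhs_nbhs; split; last by rewrite /= subrr enorm0.
apply: (@open_comp _ _ (fun z => enorm (z - x)) [set t | t < d]); last first.
  exact: open_lt.
move=> z _; apply: (@continuous_comp _ _ _ (fun z => z - x) (@enorm R n)).
  exact: (cvgD cvg_id (cvg_cst (- x))).
exact: enorm_continuous.
Qed.

(** The segment from [x] to a point of the ball stays within distance [r] of [x],
hence does not meet the boundary, so its part in [Omega] is relatively open and closed; by connectedness it is the whole
segment. *)
Lemma closed_ball_sub Omega x (r : R) : open Omega -> inner Omega r x ->
  [set y | enorm (y - x) <= r] `<=` Omega.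
Proof.
move=> oO [Ox rx] y /= yx.
pose f (t : R) := x + t *: (y - x).
have f01 t : t \in `[0, 1] -> enorm (x - f t) <= r.
  rewrite in_itv /= => /andP[t0 t1].
  rewrite /f opprD addrA subrr add0r enormN enormZ// (le_trans _ yx)//.
  by rewrite ler_piMl ?enorm_ge0.
have Sconn : connected (f @` `[0, 1]).
  apply: connected_continuous_connected; first exact: segment_connected.
  apply: continuous_subspaceT => t.
  exact: (cvgD (cvg_cst x) (cvgZr_tmp (s := id) cvg_id)).
have fb t : t \in `[0, 1] -> ~ boundary Omega (f t).
  move=> t01 ft; move: rx; apply/negP; rewrite -leNgt.
  apply: (@le_trans _ _ (enorm (x - f t))%:E); last by rewrite lee_fin f01.
  by apply: ereal_inf_lbound; exists (f t).
have f0 : f 0 = x by rewrite /f scale0r addr0.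
have f1 : f 1 = y by rewrite /f scale1r addrC subrK.
have : f @` `[0, 1] `&` Omega = f @` `[0, 1].
  apply: Sconn.
  - exists x; split => //; exists 0 => //.
    by rewrite /= in_itv /= lexx ler01.
  - by exists Omega.
  - exists (closure Omega); first exact: closed_closure.
    apply/seteqP; split=> z [Sz Oz]; split => //; first exact: subset_closure.
    apply: contrapT => nOz; case: Sz => t t01 ftz.
    by apply: (fb t) => //; rewrite ftz; exact: closureE_boundary.
move=> /seteqP[_ /(_ y)[]//]; exists 1 => //.
by rewrite /= in_itv /= lexx ler01.
Qed.

Lemma dist_boundary_lt Omega x (r s : R) : r < s -> Omega x ->
  ~ inner Omega r x -> exists2 z, boundary Omega z & enorm (x - z) < s.
Proof.
move=> rs Ox nx.
have : (dist x (boundary Omega) < s%:E)%E.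
  rewrite (@le_lt_trans _ _ r%:E) ?lte_fin// leNgt; apply/negP => rx.
  exact: nx.
by move/ereal_inf_lt => [_ [z bz <-]]; rewrite lte_fin => zs; exists z.
Qed.

Lemma boundary_modulus_near Omega (k : R -> R) u :
  continuous_near_boundary Omega k u ->
  exists C d0 : R, [/\ 0 < C, 0 < d0 & forall d x y, 0 < d -> d < d0 ->
    Omega x -> boundary Omega y -> enorm (x - y) < d ->
    `|u x - u y| <= C * k d].
Proof.
move=> [C C0 [e /= e0 H]]; exists C, e; split => // d x y d0 de Ox By xy.
have := H d; rewrite /= sub0r normrN gtr0_norm// => /(_ de d0).
rewrite -lee_fin; apply: le_trans.
by apply: ereal_sup_ubound; exists x, y; split.
Qed.

End Boundary.

(** * Scaling of the modulus of continuity *)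

Section Modulus.
Context {R : realType} (k : R -> R).
Hypothesis k_mod : modulus_of_continuity k.
Hypothesis k_gt0 : forall t : R, 0 < t -> 0 < k t.

Lemma modulus_natmul m (t : R) : 0 <= t -> k (m%:R * t) <= m%:R * k t.
Proof.
move=> t0; elim: m => [|m IH]; first by rewrite !mul0r (modulus0 k_mod).
rewrite -natr1 !mulrDl !mul1r.
rewrite (le_trans (modulus_subadditive k_mod _ _))// ?lerD2r//.
by rewrite mulr_ge0.
Qed.

Lemma limsup_lt_half (A c : R) : 0 < A -> c <= 1 / 2 ->
  (limf_esup (fun t : R => (k (A * t) / (A * k t))%:E) 0^'+ < c%:E)%E ->
  exists2 t0 : R, 0 < t0 & forall t, 0 < t -> t < t0 -> k (A * t) <= A / 2 * k t.
Proof.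
move=> A0 c2 /ereal_inf_lt[_ [V [e /= e0 eV] <-]] Vc.
exists e => // t t0 te.
have Vt : V t by apply: eV => //=; rewrite sub0r normrN gtr0_norm.
have Akt : 0 < A * k t by rewrite mulr_gt0// k_gt0.
have : ((k (A * t) / (A * k t))%:E < c%:E)%E.
  by apply: le_lt_trans Vc; apply: ereal_sup_ubound; exists t.
rewrite lte_fin ltr_pdivrMr//; have := ler_wpM2r (ltW Akt) c2; lra.
Qed.

(** If [A < 1], the smallest integer [m > 1 / A] satisfies [m * A <= 1 + A < 2],
and subadditivity gives [k t <= m * k (A * t) <= (m * A / 2) * k t < k t]. *)
Lemma half_scale_ge1 (A t0 : R) : 0 < A -> 0 < t0 ->
  (forall t, 0 < t -> t < t0 -> k (A * t) <= A / 2 * k t) -> 1 <= A.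
Proof.
move=> A0 t00 H; rewrite leNgt; apply/negP => A1.
pose t := t0 / 2; have tt0 : 0 < t by rewrite divr_gt0.
have At0 : 0 < A * t by rewrite mulr_gt0.
have /andP[m1 m2] := truncn_itv (ltW (divr_gt0 ltr01 A0)).
set m := Num.truncn _ in m1 m2.
have kt : k t <= m.+1%:R * k (A * t).
  apply: le_trans (modulus_natmul _ _ (ltW At0)).
  apply: (modulus_increasing k_mod); first exact: ltW.
  rewrite mulrA ler_pMl// -ler_pdivrMr// ltW//.
have := H t tt0; rewrite /t gtr_pMr// invf_lt1// ltr1n => /(_ isT).
rewrite -/t => kA; have k0 := k_gt0 t tt0.
have : m.+1%:R * A <= 1 + A.
  by rewrite -natr1 mulrDl mul1r lerD2r -ler_pdivlMr.
have : 0 <= m.+1%:R :> R by [].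
nra.
Qed.

(** [B = A ^ (n + 1)] for the [A] of the limsup condition.  Then [B >= 1], so
[k t <= k (B * t) <= B / 2 ^ (n + 1) * k t], and therefore
[B >= 2 ^ (n + 1) >= 2]. *)
Lemma modulus_scale (A c : R) (n : nat) : 0 < A -> c <= 1 / 2 ->
  (limf_esup (fun t : R => (k (A * t) / (A * k t))%:E) 0^'+ < c%:E)%E ->
  exists B t1 : R, [/\ 2 <= B, 0 < t1 &
    forall t, 0 < t -> t < t1 -> k (B * t) <= B / 2 ^+ n.+1 * k t].
Proof.
move=> A0 c2 /(limsup_lt_half _ _ A0 c2)[t0 t00 H].
have A1 := half_scale_ge1 _ _ A0 t00 H.
pose B := A ^+ n.+1.
have B0 : 0 < B by rewrite exprn_gt0.
have iter j t : 0 < t -> A ^+ j * t < t0 -> k (A ^+ j * t) <= (A / 2) ^+ j * k t.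
  move=> tgt0; elim: j => [|j IH] jt; first by rewrite !expr0 !mul1r.
  have jt0 : A ^+ j * t < t0.
    by rewrite (le_lt_trans _ jt)// exprS -mulrA ler_peMl// ltW// mulr_gt0// exprn_gt0.
  rewrite !exprS -!mulrA (le_trans (H _ _ jt0))//; first by rewrite mulr_gt0// exprn_gt0.
  by rewrite -mulrA ler_pM2l// ler_pM2l ?invr_gt0// IH.
exists B, (t0 / B).
have BH t : 0 < t -> t < t0 / B -> k (B * t) <= B / 2 ^+ n.+1 * k t.
  move=> tgt0 tB; rewrite -expr_div_n iter// mulrC -ltr_pdivlMr//.
split => //; last by rewrite divr_gt0.
pose t := t0 / B / 2.
have tgt0 : 0 < t by rewrite !divr_gt0.
have tB : t < t0 / B by rewrite gtr_pMr ?divr_gt0// invf_lt1// ltr1n.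
have := BH t tgt0 tB.
have : k t <= k (B * t).
  by apply: (modulus_increasing k_mod); [exact: ltW | rewrite ler_peMl ?exprn_ege1// ltW].
move=> /le_trans/[apply].
rewrite -[X in X <= _ -> _]mul1r ler_pM2r ?k_gt0// ler_pdivlMr ?exprn_gt0// mul1r.
by apply: le_trans; rewrite exprS ler_peMr// exprn_ege1// ler1n.
Qed.

End Modulus.

(** The reverse of Bernoulli's inequality on [[0, 1]]: the convex function
[h |-> (1 + h) ^ n] lies below its chord. *)
Lemma bernoulli_le {R : realType} n (h : R) : 0 <= h -> h <= 1 ->
  (1 + h) ^+ n <= 1 + (2 ^+ n - 1) * h.
Proof.
move=> h0 h1; elim: n => [|n IH]; first by rewrite !expr0 subrr mul0r addr0.
have p1 : (1 : R) <= 2 ^+ n by rewrite exprn_ege1// ler1n.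
rewrite !exprS (le_trans (ler_wpM2l _ IH)) ?addr_ge0//.
set p := 2 ^+ n in p1 *.
have : 0 <= (p - 1) * (h * (1 - h)) by rewrite !mulr_ge0// subr_ge0.
lra.
Qed.

Lemma ball_ratio_le {R : realType} n (B : R) : 2 <= B ->
  (B / (B - 1)) ^+ n <= 1 + 2 ^+ n.+1 / B.
Proof.
move=> B2.
have B10 : 0 < B - 1 by lra.
have B0 : 0 < B by lra.
have -> : B / (B - 1) = 1 + (B - 1)^-1.
  by rewrite -[X in X / _ = _](subrK 1 B) mulrDl mulfV ?gt_eqF// mul1r.
have h1 : (B - 1)^-1 <= 1 by rewrite invf_le1//; lra.
have h0 : 0 <= (B - 1)^-1 by rewrite invr_ge0 ltW.
rewrite (le_trans (bernoulli_le n _ h0 h1))// lerD2l exprS.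
rewrite [2 * _]mulrC -mulrA.
apply: (@le_trans _ _ (2 ^+ n * (B - 1)^-1)).
  by rewrite ler_wpM2r// gerBl.
rewrite ler_wpM2l ?exprn_ge0// ler_pdivlMr// mulrC ler_pdivrMr//; lra.
Qed.

(** * From one scale to all scales *)

(** [w] bounds the oscillation of [u] around [x] at scale [B * d] and [c] the
excess of the mean over the value at that scale; the conclusion bounds the
increment at scale [d].  Its main term in [w] is only [2 ^ (n + 1) / B * w]. *)
Lemma one_scale_estimate {R : realType} {n : nat} (Omega : set 'rV[R]_n)
    (u : 'rV[R]_n -> R) (M B d c w : R) (x y : 'rV[R]_n) :
  open Omega -> subharmonic Omega u -> (forall z, Omega z -> `|u z| <= M) ->
  2 <= B -> 0 < d -> inner Omega (B * d) x -> enorm (y - x) <= d ->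
  ball_mean (B * d) u x - u x <= c ->
  (forall z, Omega z -> enorm (z - x) <= B * d -> u x - u z <= w) ->
  u y - u x <= (1 + 2 ^+ n.+1 / B) * (c + w) - w.
Proof.
move=> oO [uscu mvu] uM B2 d0 xin yx meanx osc.
have B10 : 0 < B - 1 by lra.
have r0 : 0 < (B - 1) * d by rewrite mulr_gt0.
have xO := closed_ball_sub _ _ _ oO xin.
have rrho : (B - 1) * d + enorm (y - x) <= B * d by lra.
have yO : [set z | enorm (z - y) <= (B - 1) * d] `<=` Omega.
  move=> z /= zy; apply: xO => /=.
  by rewrite (le_trans (enorm_triangle y _ _))// (le_trans _ rrho)// lerD2r.
have w0 : 0 <= w.
  have := osc x xin.1; rewrite !subrr enorm0; apply.
  by rewrite mulr_ge0// ltW//; lra.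
have uy := mvu y _ r0 yO.
(* The lower bound of u on the large ball is u x - w. *)
have low z : enorm (z - x) <= B * d -> u x - w <= u z.
  by move=> zx; rewrite lerBlDr addrC -lerBlDr; apply: osc => //; exact: xO.
have := ball_mean_le Omega u M x y _ _ _ oO uscu uM r0 rrho xO low.
have -> : B * d / ((B - 1) * d) = B / (B - 1) by field; lra.
have Bd0 : 0 < B * d by rewrite mulr_gt0//; lra.
have c0 : 0 <= c by have := mvu x _ Bd0 xO; lra.
set q := (B / (B - 1)) ^+ n => H.
have q0 : 0 <= q by rewrite exprn_ge0// divr_ge0//; lra.
have mean_le : q * (ball_mean (B * d) u x - (u x - w)) <= q * (c + w).
  by rewrite ler_wpM2l//; lra.
have : q * (c + w) <= (1 + 2 ^+ n.+1 / B) * (c + w).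
  by rewrite ler_wpM2r ?addr_ge0// ball_ratio_le.
lra.
Qed.

Section Interior.
Context {R : realType} {n : nat} (Omega : set 'rV[R]_n) (u ubar : 'rV[R]_n -> R).
Context (k : R -> R) (M C0 delta1 C delta2 B t1 : R).
Hypothesis open_Omega : open Omega.
Hypothesis u_sub : subharmonic Omega u.
Hypothesis u_bnd : forall z, Omega z -> `|u z| <= M.
Hypothesis ubarE : forall z, Omega z -> ubar z = u z.
Hypothesis k_mod : modulus_of_continuity k.
Hypothesis k_gt0 : forall t : R, 0 < t -> 0 < k t.
Hypothesis C0_gt0 : 0 < C0.
Hypothesis delta1_gt0 : 0 < delta1.
Hypothesis mean_bnd : forall d : R, 0 < d -> d < delta1 ->
  forall x, inner Omega d x -> ball_mean d u x - u x <= C0 * k d.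
Hypothesis C_gt0 : 0 < C.
Hypothesis delta2_gt0 : 0 < delta2.
Hypothesis bdry_bnd : forall d x y, 0 < d -> d < delta2 ->
  Omega x -> boundary Omega y -> enorm (x - y) < d -> `|ubar x - ubar y| <= C * k d.
Hypothesis B_ge2 : 2 <= B.
Hypothesis t1_gt0 : 0 < t1.
Hypothesis k_scale : forall t, 0 < t -> t < t1 -> k (B * t) <= B / 2 ^+ n.+2 * k t.

(** Induction on the number of multiplications by [B] that take [d] up to the
fixed scale [ds], below which all the small-scale hypotheses apply.  One constant
[L] serves all scales: the one-scale estimate turns the bound [L * k (B * d)]
at scale [B * d] into [O(k d) + (L / 2) * k d] at scale [d], and [L] is chosen
large enough for this to be at most [L * k d]. *)
Lemma modulus_interior : exists2 L : R, 0 < L & forall d x y, 0 < d ->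
  Omega x -> Omega y -> enorm (y - x) <= d -> u y - u x <= L * k d.
Proof.
have B0 : 0 < B by rewrite (lt_le_trans _ B_ge2).
pose ds := Num.min (Num.min t1 (delta1 / B)) (delta2 / (B + 2)).
have ds0 : 0 < ds by rewrite !lt_min t1_gt0 !divr_gt0//; lra.
have [N NB] : exists N : nat, B + 2 <= N%:R.
  by exists (Num.bound (B + 2)); rewrite ltW// archi_boundP//; lra.
have kN t d : 0 < d -> 0 <= t -> t <= B + 2 -> k (t * d) <= N%:R * k d.
  move=> d0 t0 tB; apply: le_trans (modulus_natmul _ k_mod _ _ (ltW d0)).
  apply: (modulus_increasing k_mod); first by rewrite mulr_ge0// ltW.
  by rewrite ler_wpM2r ?(ltW d0)// (le_trans tB).
have kds0 := k_gt0 _ ds0.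
have N0 : 0 <= N%:R :> R by [].
(* The three summands of L answer for the scales above ds, for points near the
   boundary and for interior points. *)
pose L := 2 * `|M| / k ds + 2 * C * N%:R + C0 * (2 * N%:R + 1).
have L1 : 0 <= 2 * `|M| / k ds by rewrite divr_ge0 ?mulr_ge0// ltW.
have L2 : 0 <= 2 * C * N%:R by rewrite !mulr_ge0// ltW.
have L3 : 0 < C0 * (2 * N%:R + 1) by rewrite mulr_gt0// ltr_wpDl// mulr_ge0.
have L0 : 0 < L by rewrite /L ltr_wpDl// addr_ge0.
exists L => //.
have scales j : forall d x y, 0 < d -> ds <= B ^+ j * d ->
    Omega x -> Omega y -> enorm (y - x) <= d -> u y - u x <= L * k d.
  have large d x y : 0 < d -> ds <= d -> Omega x -> Omega y -> u y - u x <= L * k d.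
    move=> d0 dsd Ox Oy; apply: (@le_trans _ _ (L * k ds)); last first.
      by rewrite ler_pM2l//; apply: (modulus_increasing k_mod) => //; exact: ltW.
    apply: (@le_trans _ _ (2 * `|M| / k ds * k ds)); last first.
      by rewrite ler_wpM2r ?(ltW kds0)// /L -addrA lerDl addr_ge0// ltW.
    rewrite divfK ?gt_eqF//; have := u_bnd _ Ox; have := u_bnd _ Oy.
    rewrite !ler_norml => /andP[_ uy] /andP[ux _]; have := ler_norm M; lra.
  elim: j => [|j IH] d x y d0; first by rewrite expr0 mul1r => *; exact: large.
  rewrite exprSr -mulrA => dsB Ox Oy yx.
  have [dds|dds] := leP ds d; first exact: large.
  move: dds; rewrite !lt_min => /andP[/andP[dt1 dd1] dd2].
  have Bd0 : 0 < B * d by rewrite mulr_gt0.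
  have kd0 := k_gt0 _ d0.
  have [xin|xnin] := pselect (inner Omega (B * d) x).
    have dd1' : B * d < delta1 by rewrite mulrC -ltr_pdivlMr.
    have osc z : Omega z -> enorm (z - x) <= B * d -> u x - u z <= L * k (B * d).
      by move=> Oz zx; apply: IH => //; rewrite enormC.
    have := one_scale_estimate _ _ _ _ _ _ _ _ _ open_Omega u_sub u_bnd
      B_ge2 d0 xin yx (mean_bnd _ Bd0 dd1' _ xin) osc.
    have kB : k (B * d) <= N%:R * k d by apply: kN; lra.
    (* The smallness of k at scale B d compensates the coefficient of the
       oscillation up to a factor 1 / 2. *)
    have eK : 2 ^+ n.+1 / B * k (B * d) <= k d / 2.
      have -> : k d / 2 = 2 ^+ n.+1 / B * (B / 2 ^+ n.+2 * k d).
        rewrite (exprS 2 n.+1); field.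
        by rewrite expf_neq0//= gt_eqF.
      by rewrite ler_wpM2l ?divr_ge0 ?exprn_ge0 ?(ltW B0)// k_scale.
    have L4 : C0 * (2 * N%:R + 1) <= L by rewrite /L lerDr addr_ge0.
    set e := 2 ^+ n.+1 / B in eK *; set K := k (B * d) in kB eK *.
    have h1 : (C0 + L) * (e * K) <= (C0 + L) * (k d / 2).
      by rewrite ler_wpM2l// addr_ge0// ltW.
    have h2 : C0 * K <= C0 * (N%:R * k d) by rewrite ler_pM2l.
    have h3 : C0 * (2 * N%:R + 1) * k d <= L * k d by rewrite ler_pM2r.
    lra.
  have BB1 : B * d < (B + 1) * d by rewrite ltr_pM2r// ltrDl.
  have [z bz xz] := dist_boundary_lt _ _ _ _ BB1 Ox xnin.
  have B2d0 : 0 < (B + 2) * d by rewrite mulr_gt0//; lra.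
  have B2d2 : (B + 2) * d < delta2 by rewrite mulrC -ltr_pdivlMr//; lra.
  have yz : enorm (y - z) < (B + 2) * d.
    by rewrite (le_lt_trans (enorm_triangle x _ _))//; lra.
  have xz' : enorm (x - z) < (B + 2) * d by lra.
  have := bdry_bnd _ _ _ B2d0 B2d2 Ox bz xz'.
  have := bdry_bnd _ _ _ B2d0 B2d2 Oy bz yz.
  rewrite (ubarE x)// (ubarE y)// !ler_norml => /andP[_ h1] /andP[h2 _].
  have h3 : C * k ((B + 2) * d) <= C * (N%:R * k d) by rewrite ler_pM2l// kN//; lra.
  have h4 : 2 * C * N%:R * k d <= L * k d.
    by rewrite ler_pM2r// /L -addrA addrCA lerDl addr_ge0// ltW.
  lra.
move=> d x y d0; apply: (scales (Num.bound (ds / d))) => //.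
rewrite -ler_pdivrMr// (le_trans (ltW (archi_boundP _)))//.
  by rewrite divr_ge0// ltW.
set j := Num.bound _.
apply: (@le_trans _ _ (2 ^+ j)); first by rewrite -natrX ler_nat ltnW// ltn_expl.
by rewrite lerXn2r ?nnegrE// ltW.
Qed.

(** Points of the closure are replaced by points of [Omega] at distance at most
[|x - y|], which keeps the distance below [3 |x - y|] and costs [C * k |x - y|]
each.  For large [|x - y|] the same replacement at a fixed scale shows that
[ubar] is bounded. *)
Lemma modulus_closure : modulus_continuous_on (closure Omega) k ubar.
Proof.
have [L L0 HL] := modulus_interior.
have HLa d x y : 0 < d -> Omega x -> Omega y -> enorm (x - y) <= d ->
    `|ubar x - ubar y| <= L * k d.
  move=> d0 Ox Oy xy; rewrite !ubarE// ler_norml lerNl opprB !HL//.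
  by rewrite enormC.
have approx d x : 0 < d -> d < delta2 -> closure Omega x ->
    exists x', [/\ Omega x', enorm (x - x') <= d & `|ubar x - ubar x'| <= C * k d].
  move=> d0 d2 cx; have kd0 := k_gt0 _ d0.
  have [Ox|nOx] := pselect (Omega x).
    by exists x; rewrite !subrr enorm0 normr0 mulr_ge0// ltW.
  have [x' [Ox' /= x'x]] := cx _ (nbhs_enorm x d d0).
  exists x'; split => //.
    by rewrite enormC ltW.
  rewrite distrC; apply: bdry_bnd => //.
  exact: closureE_boundary.
pose d' := delta2 / 2.
have d'0 : 0 < d' by rewrite divr_gt0.
have d'2 : d' < delta2 by rewrite gtr_pMr// invf_lt1// ltr1n.
have kd'0 := k_gt0 _ d'0.
have K0 : 0 <= 2 * `|M| / k d' by rewrite divr_ge0 ?mulr_ge0// ltW.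
exists (2 * C + 3 * L + 2 * `|M| / k d') => [|x y cx cy].
  by rewrite ltr_pwDl// addr_gt0// mulr_gt0.
have [xy0|xy0] := eqVneq (enorm (x - y)) 0.
  rewrite xy0 (modulus0 k_mod) mulr0.
  by rewrite (subr0_eq (enorm_eq0 _ xy0)) subrr normr0.
set d := enorm (x - y) in xy0 *.
have d0 : 0 < d by rewrite lt0r xy0 enorm_ge0.
have kd0 := k_gt0 _ d0.
have [dd|dd] := ltP d delta2.
  have [x' [Ox' xx' ux]] := approx d x d0 dd cx.
  have [y' [Oy' yy' uy]] := approx d y d0 dd cy.
  have xy' : enorm (x' - y') <= 3%:R * d.
    rewrite (le_trans (enorm_triangle x _ _))// enormC.
    have := enorm_triangle y x y'; rewrite -/d; lra.
  have d30 : 0 < 3%:R * d by rewrite mulr_gt0.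
  have := HLa _ _ _ d30 Ox' Oy' xy'.
  have : L * k (3%:R * d) <= L * (3%:R * k d).
    by rewrite ler_pM2l// modulus_natmul// ltW.
  have KK : 0 <= 2 * `|M| / k d' * k d by rewrite mulr_ge0// ltW.
  move: ux uy; rewrite !ler_norml; lra.
have [x' [Ox' xx' ux]] := approx d' x d'0 d'2 cx.
have [y' [Oy' yy' uy]] := approx d' y d'0 d'2 cy.
have kk : k d' <= k d.
  by apply: (modulus_increasing k_mod); [exact: ltW | lra].
have h1 : C * k d' <= C * k d by rewrite ler_pM2l.
have h2 : 2 * `|M| <= 2 * `|M| / k d' * k d.
  by rewrite -[leLHS](divfK (lt0r_neq0 kd'0)) ler_wpM2l.
have h3 : 0 <= L * k d by rewrite mulr_ge0// ltW.
have := u_bnd _ Ox'; have := u_bnd _ Oy'; rewrite -!ubarE//.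
have := ler_norm M; move: ux uy; rewrite !ler_norml; lra.
Qed.

End Interior.

Theorem mainTheorem2 (R : realType) (n : nat) (n_gt0 : (0 < n)%N)
  (Omega : set 'rV[R]_n) (delta0 : R) (u : 'rV[R]_n -> R) (kappa : R -> R) :
  domain Omega ->
  0 < delta0 -> inner Omega delta0 !=set0 ->
  bounded_fun_on Omega u -> subharmonic Omega u ->
  modulus_of_continuity kappa -> (forall t : R, 0 < t -> 0 < kappa t) ->
  (exists2 A : R, 0 < A &
     (limf_esup (fun t : R => (kappa (A * t) / (A * kappa t))%:E) 0^'+
        < (1 / (2 * n%:R))%:E)%E) ->
  (exists C0 delta1 : R, [/\ 0 < C0, 0 < delta1, delta1 < delta0 &
     forall delta : R, 0 < delta -> delta < delta1 ->
       forall x, inner Omega delta x ->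
         ball_mean delta u x - u x <= C0 * kappa delta]) ->
  forall ubar : 'rV[R]_n -> R,
    (forall x, Omega x -> ubar x = u x) ->
    continuous_near_boundary Omega kappa ubar ->
    modulus_continuous_on (closure Omega) kappa ubar.
Proof.
move=> [open_Omega _ _] _ _ [M u_bnd] u_sub k_mod k_gt0 [A A0 limA].
move=> [C0 [delta1 [C00 delta10 _ mean_bnd]]] ubar ubarE.
move=> /boundary_modulus_near[C [delta2 [C_gt0 delta20 bdry_bnd]]].
have c2 : 1 / (2 * n%:R) <= 1 / 2 :> R.
  rewrite !div1r lef_pV2 ?posrE ?mulr_gt0 ?ltr0n//.
  by rewrite ler_peMr// ler1n.
have [B [t1 [B2 t10 k_scale]]] := modulus_scale _ k_mod k_gt0 _ _ n.+1 A0 c2 limA.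
exact: (modulus_closure _ u _ _ M C0 delta1 C delta2 B t1).
Qed.
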